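(* Let $n\geq 2$ and let $f:(0,1)\to[0,1]^n$ be an arbitrary size cube packing (i.e. an arbitrary map). Let $$G=T(f)=\bigcup_{t\in(0,1)}\bigl(tK_{n-1}+f(t)\bigr)\subset\mathbb{R}^n .$$ Then $$\dim_{\mathrm{A}} G\;\geq\;\underline{\dim}_{\mathrm{B}}\, G\;\geq\; n-\tfrac12 ,\qquad\text{and}\qquad \dim_{\mathrm{H}} G\;\geq\; n-1 .$$
   Context: Let $K=[-0.5,0.5]^n\subset\mathbb{R}^n$ be the unit cube and $K_{n-1}=\partial K$ its topological boundary (the union of its $2n$ faces); all cubes are aligned with the coordinate axes. For $t>0$ and $x\in\mathbb{R}^n$, $tK_{n-1}+x=\{ty+x: y\in K_{n-1}\}$ is the boundary of the axis-parallel cube of side length $t$ centred at $x$. A size cube packing is any map $f:(0,1)\to[0,1]^n$ (no regularity assumed); its image is $T(f)=\bigcup_{t\in(0,1)}(tK_{n-1}+f(t))$. $\dim_{\mathrm{H}}$ denotes Hausdorff dimension. For a set $F\subset\mathbb{R}^n$ and $r>0$, $N_r(F)$ is the minimal number of cubes of side length $r$ needed to cover $F$. The lower box dimension is $\underline{\dim}_{\mathrm{B}} F=\liminf_{r\to0}\bigl(-\log N_r(F)/\log r\bigr)$. The Assouad dimension is $$\dim_{\mathrm{A}}F=\inf\Bigl\{s\ge0:\ \exists C>0\ \forall R>0\ \forall r\in(0,R)\ \forall x\in F,\ N_r(B(x,R)\cap F)\le C(R/r)^s\Bigr\},$$ where $B(x,R)$ is the closed ball of centre $x$ and radius $R$.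 *)

(* Defs.v *)
From HB Require Import structures.
From mathcomp Require Import all_boot all_order all_algebra.
From mathcomp Require Import all_classical all_reals all_analysis.
Set Implicit Arguments.
Unset Strict Implicit.
Unset Printing Implicit Defensive.
Import Order.TTheory GRing.Theory Num.Theory.
Import numFieldNormedType.Exports.
Local Open Scope classical_set_scope.
Local Open Scope ring_scope.

Definition boundary (T : topologicalType) (A : set T) : set T :=
  closure A `\` interior A.

(* The library's norm on row vectors is the sup norm, whence this Euclidean
   distance for balls and diameters. *)
Definition euclidean_dist (R : realType) (n : nat) (x y : 'rV[R]_n) : R :=
  Num.sqrt (\sum_(i < n) (x 0 i - y 0 i) ^+ 2).

Definition euclidean_closed_ball (R : realType) (n : nat)
    (x : 'rV[R]_n) (r : R) : set 'rV[R]_n :=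
  [set y | euclidean_dist x y <= r].

(* The cube [-1/2, 1/2]^n *)
Definition unit_cube (R : realType) (n : nat) : set 'rV[R]_n :=
  [set x | forall i, - 2^-1 <= x 0 i <= 2^-1].

(* t A + x *)
Definition homothet (R : realType) (n : nat) (t : R) (x : 'rV[R]_n)
    (A : set 'rV[R]_n) : set 'rV[R]_n :=
  [set t *: y + x | y in A].

Definition cube_boundary_union (R : realType) (n : nat)
    (f : R -> 'rV[R]_n) : set 'rV[R]_n :=
  \bigcup_(t in `]0, 1[) homothet t (f t) (boundary (@unit_cube R n)).

(* [f] is total on R, but only its values on (0, 1) are constrained, and only
   those matter to [cube_boundary_union f]. *)
Definition size_cube_packing (R : realType) (n : nat)
    (f : R -> 'rV[R]_n) : Prop :=
  forall t : R, 0 < t < 1 -> forall i, 0 <= f t 0 i <= 1.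

Local Open Scope ereal_scope.

(* N_r(F), equal to +oo when no finite cover exists *)
Definition covering_number (R : realType) (n : nat) (r : R)
    (F : set 'rV[R]_n) : \bar R :=
  ereal_inf [set (k%:R)%:E | k in [set k : nat | exists c : 'I_k -> 'rV[R]_n,
    F `<=` \bigcup_i homothet r (c i) (@unit_cube R n)]].

Definition lower_box_dim (R : realType) (n : nat) (F : set 'rV[R]_n) : \bar R :=
  limf_einf (fun r : R => - lne (covering_number r F) * ((ln r)^-1)%:E) 0^'+.

Definition assouad_dim (R : realType) (n : nat) (F : set 'rV[R]_n) : \bar R :=
  ereal_inf [set s%:E | s in [set s : R | (0 <= s)%R /\
    exists2 C : R, (0 < C)%R &
      forall rho r : R, (0 < r < rho)%R -> forall x, F x ->
        covering_number r (euclidean_closed_ball x rho `&` F)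
          <= (C * (rho / r) `^ s)%:E]].

(* -oo on the empty set *)
Definition diam (R : realType) (n : nat) (U : set 'rV[R]_n) : \bar R :=
  ereal_sup [set (euclidean_dist p.1 p.2)%:E | p in U `*` U].

(* |U|^s with |set0|^s = 0 and |{x}|^0 = 1, so that the 0-dimensional Hausdorff
   measure is the counting measure *)
Definition diam_pow (R : realType) (n : nat) (s : R) (U : set 'rV[R]_n) :
    \bar R :=
  if U == set0 then 0 else poweR (diam U) s.

Definition hausdorff_premeasure (R : realType) (n : nat) (s delta : R)
    (F : set 'rV[R]_n) : \bar R :=
  ereal_inf [set \sum_(0 <= k <oo) diam_pow s (U k) | U in
    [set U : nat -> set 'rV[R]_n |
      F `<=` \bigcup_k U k /\ forall k, diam (U k) <= delta%:E]].

Definition hausdorff_measure (R : realType) (n : nat) (s : R)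
    (F : set 'rV[R]_n) : \bar R :=
  ereal_sup [set hausdorff_premeasure s delta F | delta in
    [set delta : R | (0 < delta)%R]].

Definition hausdorff_dim (R : realType) (n : nat) (F : set 'rV[R]_n) : \bar R :=
  ereal_inf [set s%:E | s in
    [set s : R | (0 <= s)%R /\ hausdorff_measure s F = 0]].

(* Main.v *)
Require Import Defs.
From HB Require Import structures.
From mathcomp Require Import all_boot all_order all_algebra.
From mathcomp Require Import all_classical all_reals all_analysis.
From mathcomp Require Import zify ring lra.
Import Order.TTheory GRing.Theory Num.Theory.
Import numFieldNormedType.Exports.
Set Implicit Arguments.
Unset Strict Implicit.
Unset Printing Implicit Defensive.
Local Open Scope classical_set_scope.
Local Open Scope ring_scope.

(** Write n = d + 1 and let G be the union of the cube boundaries.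

    Lower box dimension. Look only at the faces orthogonal to the 0-th axis.
    The boundary of size t has two of them, at positions a and a + t, so the
    pair of positions determines t. Sort positions into cells of width 2r and
    use about 1/r sizes in [1/2, 1) spaced by 4r: distinct sizes give distinct
    pairs of cells, so at least of the order of r^(-1/2) cells are met. Each
    cell contains a whole d-dimensional face of side at least 1/2, which
    contains of the order of r^(-d) points that are 2r-separated. A cube of
    side r sees at most two consecutive cells and at most one grid point of
    the face chosen in each, so a cover of G by cubes of side r has at least
    of the order of r^(-d-1/2) members ([cover_card_lower_bound]); taking
    logarithms gives [lower_box_dim_ge].

    Assouad dimension. The centres lie in the unit cube, hence G lies in a
    ball centred at one of its points, and the Assouad condition at that one
    scale already bounds the covering numbers of G
    ([lower_box_dim_le_assouad]).

    Hausdorff dimension. G contains a d-dimensional face. If its s-dimensional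
    measure vanished for some s <= d, the face would be covered by open sup-norm
    balls with arbitrarily small sum of d-th powers of radii. By compactness
    finitely many suffice, and counting the points of a fine grid of the face in
    each ball bounds that sum below by the d-volume of the face
    ([face_box_ball_cover]). *)

(** * Combinatorial counting *)

(** Along each axis the coordinates of points of S lie in a window of q
    consecutive integers, where reduction modulo q is injective. *)
Lemma card_clustered (d m q : nat) (S : {set {ffun 'I_d -> 'I_m}}) :
  (0 < q)%N ->
  (forall g g', g \in S -> g' \in S -> forall i, (g i < g' i + q)%N) ->
  (#|S| <= q ^ d)%N.
Proof.
case: q => // q _ clust.
pose residue (g : {ffun 'I_d -> 'I_m}) : {ffun 'I_d -> 'I_q.+1} :=
  [ffun i => inord (g i %% q.+1)].
rewrite -[(q.+1 ^ d)%N](_ : #|{ffun 'I_d -> 'I_q.+1}| = _)%N; last first.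
  by rewrite card_ffun !card_ord.
rewrite -(card_in_imset (f := residue)); first exact: max_card.
move=> g g' gS g'S /ffunP eq_res; apply/ffunP => i; apply/val_inj.
have := eq_res i; rewrite !ffunE => /(congr1 val).
rewrite /= !inordK ?ltn_mod// => eq_mod.
have quot_le (h h' : {ffun 'I_d -> 'I_m}) : h \in S -> h' \in S ->
    h i = h' i %[mod q.+1] -> (h i %/ q.+1 <= h' i %/ q.+1)%N.
  move=> hS h'S eq_hh'; have := clust _ _ hS h'S i.
  rewrite {1}(divn_eq (h i) q.+1) {1}(divn_eq (h' i) q.+1) eq_hh'.
  by rewrite addnAC -mulSnr ltn_add2r ltn_pmul2r.
rewrite (divn_eq (g i) q.+1) (divn_eq (g' i) q.+1) eq_mod.
by congr (_ * _ + _)%N; apply/eqP; rewrite eqn_leq !quot_le.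
Qed.

(** A section of the quotient by the kernel of c: its image has exactly one
    element for each value taken by c. *)
Lemma kernel_representative (T : finType) (C : eqType) (c : T -> C) :
  exists2 rep : T -> T, forall x, c (rep x) = c x &
    forall x y, c x = c y -> rep x = rep y.
Proof.
pose rep x := odflt x [pick y | c y == c x].
exists rep => [x|x y cxy].
  by rewrite /rep; case: pickP => [y /eqP//|/(_ x)]; rewrite eqxx.
rewrite /rep -cxy; case: pickP => // /(_ x); by rewrite eqxx.
Qed.

(** * Cube boundaries and the grids in their faces *)

(** Dilating a point of a face about the centre leaves the cube at once. *)
Lemma boundary_unit_cubeP (R : realType) (n : nat) (x : 'rV[R]_n) (i : 'I_n) :
  unit_cube x -> `|x 0 i| = 2^-1 -> boundary (@unit_cube R n) x.
Proof.
move=> xK xi; split; first exact: subset_closure.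
move=> /nbhs_ballP[e /= e0 xeK].
have : unit_cube ((1 + e) *: x).
  apply: xeK; split => // a j; rewrite ord1 mxE /ball/=.
  have := xK j; rewrite -ler_norml => xj.
  rewrite mulrDl mul1r opprD addrA subrr sub0r normrN normrM (gtr0_norm e0).
  by apply: le_lt_trans (_ : e * 2^-1 < e); [rewrite ler_pM2l|lra].
move=> /(_ i); rewrite mxE -ler_norml normrM xi gtr0_norm; lra.
Qed.

Lemma boundary_unit_cube_sub (R : realType) (n : nat) :
  boundary (@unit_cube R n) `<=` @unit_cube R n.
Proof.
move=> x [clx _] i; rewrite -ler_norml; apply/ler_addgt0Pl => e e0.
have [y [yK xy]] := clx _ (nbhsx_ballx x e e0).
have := yK i; rewrite -ler_norml => yi.
have [_ /(_ 0 i)] := xy; rewrite /ball/= => xyi.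
rewrite -(subrK (y 0 i) (x 0 i)) (le_trans (ler_normD _ _))//.
by rewrite lerD// ltW.
Qed.

(** Reduces membership in the union to inequalities between coordinates, the
    form in which all its points are produced below. *)
Lemma face_sub (R : realType) (n : nat) (f : R -> 'rV[R]_n) (t : R) (i : 'I_n)
    (x : 'rV[R]_n) :
  0 < t < 1 -> `|x 0 i - f t 0 i| = t / 2 ->
  (forall j, `|x 0 j - f t 0 j| <= t / 2) -> cube_boundary_union f x.
Proof.
move=> /[dup] t01 /andP[t0 _] xi xj; exists t; first by rewrite /= in_itv.
have normE j : `|(t^-1 *: (x - f t)) 0 j| = t^-1 * `|x 0 j - f t 0 j|.
  by rewrite !mxE normrM gtr0_norm// invr_gt0.
exists (t^-1 *: (x - f t)).
  apply: (@boundary_unit_cubeP _ _ _ i); last first.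
    by rewrite normE xi mulKf// gt_eqF.
  by move=> j; rewrite -ler_norml normE ler_pdivrMl.
by rewrite scalerA divff ?gt_eqF// scale1r subrK.
Qed.

Lemma homothet_cube_dist (R : realType) (n : nat) (r : R) (c x y : 'rV[R]_n) :
  0 < r -> homothet r c (@unit_cube R n) x -> homothet r c (@unit_cube R n) y ->
  forall i, `|x 0 i - y 0 i| <= r.
Proof.
move=> r0 [u uK <-] [v vK <-] i; rewrite !mxE.
have -> : r * u 0 i + c 0 i - (r * v 0 i + c 0 i) = r * (u 0 i - v 0 i) by ring.
rewrite normrM gtr0_norm// ler_piMr ?(ltW r0)//.
have := uK i; have := vK i; rewrite ler_norml; lra.
Qed.

(** The match on unlift separates the axis orthogonal to the face, which is the
    0-th one, from the d axes of the grid. *)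
Definition grid_point (R : realType) (d m : nat) (a : R) (b : 'rV[R]_d.+1)
    (h : R) (g : {ffun 'I_d -> 'I_m}) : 'rV[R]_d.+1 :=
  \row_i if unlift ord0 i is Some j then b 0 i + h * (g j)%:R else a.

Lemma grid_point0 (R : realType) (d m : nat) (a : R) (b : 'rV[R]_d.+1) (h : R)
    (g : {ffun 'I_d -> 'I_m}) : grid_point a b h g 0 0 = a.
Proof. by rewrite mxE unlift_none. Qed.

Lemma grid_pointS (R : realType) (d m : nat) (a : R) (b : 'rV[R]_d.+1) (h : R)
    (g : {ffun 'I_d -> 'I_m}) (j : 'I_d) :
  grid_point a b h g 0 (lift ord0 j) = b 0 (lift ord0 j) + h * (g j)%:R.
Proof. by rewrite mxE liftK. Qed.

Lemma card_grid_points (R : realType) (d m q : nat) (a : R)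
    (b : 'rV[R]_d.+1) (h : R) (S : {set {ffun 'I_d -> 'I_m}}) :
  0 < h -> (0 < q)%N ->
  (forall g g', g \in S -> g' \in S -> forall i,
     `|grid_point a b h g 0 i - grid_point a b h g' 0 i| < h * q%:R) ->
  (#|S| <= q ^ d)%N.
Proof.
move=> h0 q0 close; apply: card_clustered => // g g' gS g'S i.
have := close _ _ gS g'S (lift ord0 i); rewrite !grid_pointS => gg'.
rewrite -(ltr_nat R) natrD -(ltr_pM2l h0).
move: gg'; rewrite ltr_norml; lra.
Qed.

(** * Counting the cubes of a cover *)

(** Close reals have equal or consecutive integer parts, and parity tells these
    two cases apart. *)
Lemma floor_close (R : realType) (u v : R) :
  `|u - v| <= 2^-1 ->
  odd `|Num.floor u|%N = odd `|Num.floor v|%N -> Num.floor u = Num.floor v.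
Proof.
move=> uv.
have := floor_itv u; have := floor_itv v; rewrite !intrD => fv fu.
have lt_uv : (Num.floor u < Num.floor v + 2)%R.
  by rewrite -(ltr_int R) intrD; move: uv; rewrite ler_norml; lra.
have lt_vu : (Num.floor v < Num.floor u + 2)%R.
  by rewrite -(ltr_int R) intrD; move: uv; rewrite ler_norml; lra.
move: lt_uv lt_vu; move: (Num.floor u) (Num.floor v) => x y; lia.
Qed.

Lemma natr_close_eq (R : realType) (h : R) (i j : nat) :
  0 < h -> `|h * i%:R - h * j%:R| < h -> i = j.
Proof.
move=> h0; rewrite -mulrBr normrM (gtr0_norm h0) gtr_pMr// => ij.
have : (`|i%:Z - j%:Z| < 1)%R by rewrite -(ltr_int R) intr_norm intrB.
lia.
Qed.

(** The pigeonhole argument. If A is the number of cells of width 2r that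
    contain a face, then m <= A ^ 2, because the two cells of a cube boundary
    determine its size; and A * m ^ d <= 2 * k, because among the
    grid points of the selected faces each one is determined by a cube that
    covers it and the parity of its cell. *)
Lemma cover_card_lower_bound (R : realType) (d : nat) (f : R -> 'rV[R]_d.+1)
    (r : R) (m k : nat) (c : 'I_k -> 'rV[R]_d.+1) :
  0 < r -> r * m%:R <= 8^-1 ->
  cube_boundary_union f `<=` \bigcup_i homothet r (c i) (@unit_cube R d.+1) ->
  (m ^ (2 * d).+1 <= (2 * k) ^ 2)%N.
Proof.
move=> r0 rm cover.
have rltm (j : 'I_m) : 0 <= r * j%:R < 8^-1.
  rewrite mulr_ge0 ?(ltW r0)//= (lt_le_trans _ rm)// ltr_pM2l//.
  by rewrite ltr_nat.
(* A spacing of 4r separates sizes, since a size is the difference of two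
   positions, each known up to an error smaller than 2r. *)
pose size (j : 'I_m) : R := 2^-1 + 4 * (r * j%:R).
have size_itv j : 2^-1 <= size j < 1 by rewrite /size; have := rltm j; lra.
pose pos (z : 'I_m * bool) : R :=
  f (size z.1) 0 0 + (if z.2 then size z.1 / 2 else - (size z.1 / 2)).
(* Cells are twice as wide as the covering cubes, so that a cube meets at most
   two consecutive ones. *)
pose cell z := Num.floor (pos z / (2 * r)).
have [rep cell_rep rep_eq] := kernel_representative cell.
(* One face is kept for each cell that is met. *)
pose A := [set rep z | z : 'I_m * bool]%SET.
have rep_id z : z \in A -> rep z = z.
  by move=> /imsetP[y _ ->]; apply: rep_eq; rewrite cell_rep.
have same_cell z z' : cell z = cell z' -> `|pos z - pos z'| < 2 * r.
  rewrite /cell => eq_floor.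
  have := floor_itv (pos z / (2 * r)); have := floor_itv (pos z' / (2 * r)).
  rewrite eq_floor !intrD !ler_pdivlMr ?ltr_pdivrMr ?mulr_gt0//.
  rewrite ltr_norml; lra.
have m_le : (m <= #|A| ^ 2)%N.
  pose ends (j : 'I_m) := (rep (j, false), rep (j, true)).
  rewrite -[leqLHS]card_ord -mulnn -cardsX -(card_imset _ (f := ends)).
    by apply/subset_leq_card/fintype.subsetP => _ /imsetP[j _ ->];
      rewrite finset.in_setX !imset_f.
  move=> j j' [/(congr1 cell) + /(congr1 cell)]; rewrite !cell_rep.
  move=> /same_cell + /same_cell; rewrite /pos/= !ltr_norml /size => near0 near1.
  apply/val_inj/(natr_close_eq r0); rewrite ltr_norml.
  by move: near0 near1; lra.
pose pt (w : ('I_m * bool) * {ffun 'I_d -> 'I_m}) :=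
  grid_point (pos w.1) (f (size w.1.1) - const_mx (size w.1.1 / 2)) (2 * r) w.2.
have pt_in w : cube_boundary_union f (pt w).
  case: w => -[j s] g; have sj := size_itv j.
  apply: (@face_sub _ _ _ (size j) 0); first by lra.
    rewrite grid_point0 /pos/= addrAC subrr add0r.
    by case: s; rewrite ?normrN ger0_norm//; lra.
  move=> i; case: (unliftP ord0 i) => [i'|] ->; rewrite ?grid_point0 ?grid_pointS.
    rewrite !mxE /= ler_norml; have := rltm (g i'); lra.
  rewrite /pos/= addrAC subrr add0r.
  by case: s; rewrite ?normrN ger0_norm//; lra.
have /choice[ix ixP] w : exists i, homothet r (c i) (@unit_cube R d.+1) (pt w).
  by have [i _ ?] := cover _ (pt_in w); exists i.
pose code w := (ix w, odd `|cell w.1|%N).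
have le_k : (#|A| * m ^ d <= k * 2)%N.
  have -> : (#|A| * m ^ d)%N = #|finset.setX A [set: {ffun 'I_d -> 'I_m}]%SET|.
    by rewrite cardsX cardsT card_ffun !card_ord.
  rewrite -[(k * 2)%N](_ : #|{: 'I_k * bool}| = _); last first.
    by rewrite card_prod card_ord card_bool.
  rewrite -(card_in_imset (f := code)); first exact: max_card.
  move=> [z g] [z' g']; rewrite !inE !andbT => zA z'A [eq_ix eq_odd].
  have /= close := homothet_cube_dist r0 (ixP (z, g)).
  have {}close := close _; move: (ixP (z', g')); rewrite -eq_ix => /close {}close.
  have eq_z : z = z'.
    rewrite -(rep_id z)// -(rep_id z')//; apply: rep_eq; apply: floor_close => //.
    have := close 0; rewrite /pt !grid_point0 -mulrBl normrM => close0.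
    rewrite [X in _ * X]ger0_norm ?invr_ge0 ?mulr_ge0 ?(ltW r0)//.
    by rewrite ler_pdivrMr ?mulr_gt0// mulrA mulVf// mul1r.
  rewrite -eq_z in close *; congr (_, _); apply/ffunP => i.
  have := close (lift ord0 i); rewrite /pt !grid_pointS/= ler_norml => closei.
  by apply/val_inj/(natr_close_eq r0); rewrite ltr_norml; lra.
rewrite expnS (mulnC 2) expnM (leq_trans (n := ((#|A| * m ^ d) ^ 2)%N))//.
  by rewrite expnMn leq_mul.
by rewrite leq_exp2r// (mulnC 2).
Qed.

(** * Box and Assouad dimensions *)

(** The logarithm of r is negative, which compensates the sign in the
    numerator. *)
Lemma log_ratio_le (R : realType) (r : R) (M N : \bar R) :
  0 < r < 1 -> (0 <= M)%E -> (M <= N)%E ->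
  (- lne M * ((ln r)^-1)%:E <= - lne N * ((ln r)^-1)%:E)%E.
Proof.
move=> /andP[r0 r1] M0 MN; rewrite !mulNe -!muleN lee_wpmul2r//.
  by rewrite -EFinN lee_fin oppr_ge0 invr_le0 ltW// ln_lt0// r0.
by rewrite lee_lne// in_itv/= leey andbT// (le_trans M0).
Qed.

Lemma div_ln_near0 (R : realType) (K e : R) :
  0 < e -> \forall r \near 0^'+, K / ln r <= e.
Proof.
move=> e0; have lt0 : \forall r \near (0 : R)^'+, ln r < 0.
  by have /cvgrNyPlt := @lnNy R; apply.
have ltK : \forall r \near (0 : R)^'+, ln r <= K / e.
  by have /cvgrNyPle := @lnNy R; apply.
near=> r; have ln0 : ln r < 0 by near: r.
rewrite ler_ndivrMr// mulrC -ler_pdivlMr//; by near: r.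
Unshelve. all: by end_near. Qed.

Lemma limf_einf_at_right_ge (R : realType) (g : R -> \bar R) (a : R)
    (l : R) :
  (forall e, 0 < e -> \forall r \near a^'+, ((l - e)%:E <= g r)%E) ->
  (l%:E <= limf_einf g a^'+)%E.
Proof.
move=> lg; rewrite limf_einfE; apply/lee_subgt0Pr => e e0.
apply: le_ereal_sup_tmp; exists (ereal_inf [set g x | x in [set r | ((l - e)%:E <= g r)%E]]).
  by exists [set r | ((l - e)%:E <= g r)%E] => //; exact: lg.
by apply: le_ereal_inf_tmp => _ [r /= lr <-].
Qed.

Lemma limf_einf_at_right_le (R : realType) (g : R -> \bar R) (a : R)
    (l : R) :
  (forall e, 0 < e -> \forall r \near a^'+, (g r <= (l + e)%:E)%E) ->
  (limf_einf g a^'+ <= l%:E)%E.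
Proof.
move=> lg; rewrite limf_einfE; apply/lee_addgt0Pr => e e0.
apply: ge_ereal_sup => _ [V aV <-].
have [r [Vr gr]] := filter_ex (filterI aV (lg _ e0)).
by apply: ge_ereal_inf; exists (g r) => //; exists r.
Qed.

Lemma covering_number_ge0 (R : realType) (n : nat) (r : R) (F : set 'rV[R]_n) :
  (0 <= covering_number r F)%E.
Proof. by apply: le_ereal_inf_tmp => _ [k _ <-]; rewrite lee_fin. Qed.

(** With m the integer part of 1/(8r), which is at least 1/(16r) for small r,
    the bound m ^ (2d+1) <= (2k)^2 reads k >= (16r)^-(d+1/2) / 2. *)
Lemma covering_number_lower_bound (R : realType) (d : nat)
    (f : R -> 'rV[R]_d.+1) (r : R) :
  0 < r <= 16^-1 ->
  (((16 * r)^-1 `^ (d%:R + 2^-1) / 2)%:E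
    <= covering_number r (cube_boundary_union f))%E.
Proof.
move=> /andP[r0 r16]; apply: le_ereal_inf_tmp => _ [k [c cover] <-].
rewrite lee_fin ler_pdivrMr// (mulrC k%:R).
pose m := Num.truncn (8 * r)^-1.
have x0 : 0 <= (8 * r)^-1 by rewrite invr_ge0 mulr_ge0// ltW.
have /andP[mle mgt] := truncn_itv x0.
have rm : r * m%:R <= 8^-1.
  have : 8 * r * m%:R <= 1 by rewrite -ler_pdivlMl ?mulr_gt0// mulr1.
  lra.
have xm : (16 * r)^-1 <= m%:R.
  have x2 : 2 <= (8 * r)^-1.
    by rewrite -[leLHS]invrK lef_pV2 ?posrE ?invr_gt0 ?mulr_gt0//; lra.
  have -> : (16 * r)^-1 = (8 * r)^-1 / 2 by rewrite -invfM; congr _^-1; ring.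
  move: mgt x2; rewrite -/m -[m.+1%:R]natr1; move: (_^-1) (m%:R) => x m' ? ?.
  lra.
have := cover_card_lower_bound r0 rm cover.
rewrite -(ler_nat R) !natrX natrM => le_sq.
rewrite -(@ler_pXn2r _ 2) ?nnegrE ?powR_ge0 ?mulr_ge0//.
apply: le_trans le_sq; rewrite -powR_mulrn ?powR_ge0// -powRrM.
have -> : (d%:R + 2^-1) * 2 = (2 * d).+1%:R :> R.
  by rewrite -[(2 * d).+1%:R]natr1 natrM; lra.
rewrite powR_mulrn ?invr_ge0 ?mulr_ge0 ?(ltW r0)//.
by rewrite lerXn2r ?nnegrE// invr_ge0 mulr_ge0// ltW.
Qed.

Lemma lower_box_dim_ge (R : realType) (d : nat) (f : R -> 'rV[R]_d.+1) :
  ((d%:R + 2^-1)%:E <= lower_box_dim (cube_boundary_union f))%E.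
Proof.
apply: limf_einf_at_right_ge => e e0.
set s : R := d%:R + 2^-1; near=> r.
have r0 : 0 < r by near: r; exact: nbhs_right_gt.
have r16 : r <= 16^-1 by near: r; apply: nbhs_right_le; rewrite invr_gt0.
have r01 : 0 < r < 1 by lra.
have small : - (s * ln 16 + ln 2) / ln r <= e.
  by near: r; exact: div_ln_near0.
have P0 : 0 < (16 * r)^-1 `^ s / 2.
  by rewrite divr_gt0// powR_gt0// invr_gt0 mulr_gt0.
have r016 : 0 < r <= 16^-1 by rewrite r0.
have := log_ratio_le r01 _ (covering_number_lower_bound f r016).
rewrite lee_fin (ltW P0) => /(_ isT); apply: le_trans.
rewrite lne_EFin// -EFinN -EFinM lee_fin.
rewrite ln_div ?posrE// ?powR_gt0 ?invr_gt0 ?mulr_gt0//.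
rewrite ln_powR lnV ?posrE ?mulr_gt0// lnM ?posrE//.
have lnr : ln r != 0 by rewrite lt_eqF// ln_lt0.
have -> : - (s * - (ln 16 + ln r) - ln 2) / ln r
        = s - - (s * ln 16 + ln 2) / ln r by field.
by rewrite lerD2l lerN2.
Unshelve. all: by end_near. Qed.

Lemma cube_boundary_union_sub_ball (R : realType) (d : nat)
    (f : R -> 'rV[R]_d.+1) (x : 'rV[R]_d.+1) :
  size_cube_packing f -> cube_boundary_union f x ->
  cube_boundary_union f `<=` euclidean_closed_ball x (2 * d.+1%:R).
Proof.
move=> hf; have coord y : cube_boundary_union f y ->
    forall i, - 2^-1 <= y 0 i <= 3 / 2.
  move=> [t]; rewrite /= in_itv/= => t01 [u /boundary_unit_cube_sub uK <-] i.
  rewrite !mxE; have := hf t t01 i; have := uK i; nra.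
move=> /coord xG y /coord yG; rewrite /euclidean_closed_ball/= /euclidean_dist.
rewrite -[leRHS]ger0_norm ?mulr_ge0// -sqrtr_sqr ler_wsqrtr//.
apply: (@le_trans _ _ (\sum_(i < d.+1) 4)).
  by apply: ler_sum => i _; have := xG i; have := yG i; nra.
rewrite sumr_const card_ord -mulr_natl.
have : 1 <= d.+1%:R :> R by rewrite ler1n.
nra.
Qed.

(** In the Assouad condition only one centre and one outer radius are used; the
    constant disappears after division by the logarithm of r. *)
Lemma lower_box_dim_le_assouad (R : realType) (n : nat) (F : set 'rV[R]_n)
    (rho : R) (x : 'rV[R]_n) :
  0 < rho -> F x -> F `<=` euclidean_closed_ball x rho ->
  (lower_box_dim F <= assouad_dim F)%E.
Proof.
move=> rho0 Fx Fball; apply: le_ereal_inf_tmp => _ [s [s0 [C C0 HC]] <-].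
apply: limf_einf_at_right_le => e e0; near=> r.
have r0 : 0 < r by near: r; exact: nbhs_right_gt.
have r1 : r < 1 by near: r; exact: nbhs_right_lt.
have rrho : r < rho by near: r; exact: nbhs_right_lt.
have small : - (ln C + s * ln rho) / ln r <= e.
  by near: r; exact: div_ln_near0.
have := HC rho r _ x Fx; rewrite r0 rrho => /(_ isT).
rewrite setIC (setIidl Fball) => NC.
have r01 : 0 < r < 1 by rewrite r0.
apply: le_trans (log_ratio_le r01 (covering_number_ge0 _ _) NC) _.
have P0 : 0 < (rho / r) `^ s by rewrite powR_gt0// divr_gt0.
rewrite lne_EFin ?mulr_gt0// -EFinN -EFinM lee_fin.
rewrite lnM ?posrE// ln_powR ln_div ?posrE//.
have lnr : ln r != 0 by rewrite lt_eqF// ln_lt0.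
have -> : - (ln C + s * (ln rho - ln r)) / ln r
        = s + - (ln C + s * ln rho) / ln r by field.
by rewrite lerD2l.
Unshelve. all: by end_near. Qed.

(** * Hausdorff dimension *)

(** A box that is degenerate along the 0-th axis, written so that it is a
    product of segments: this is what compactness needs. *)
Definition face_box (R : realType) (d : nat) (b : 'rV[R]_d.+1) (h : R) :
    set 'rV[R]_d.+1 :=
  [set x | forall i, b 0 i <= x 0 i <= b 0 i + (if i == 0 then 0 else h)].

Lemma face_box_compact (R : realType) (d : nat) (b : 'rV[R]_d.+1) (h : R) :
  compact (face_box b h).
Proof.
have := @rV_compact R d.+1
  (fun i => `[b 0 i, b 0 i + (if i == 0 then 0 else h)]%classic)
  (fun=> @segment_compact R _ _).
by congr compact; apply/seteqP; split => x /= xb i; have := xb i; rewrite /= in_itv.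
Qed.

Lemma face_box_sub (R : realType) (d : nat) (f : R -> 'rV[R]_d.+1) (t : R) :
  0 < t < 1 ->
  face_box (f t - const_mx (t / 2)) t `<=` cube_boundary_union f.
Proof.
move=> t01 x xb; apply: (@face_sub _ _ _ t 0) => // [|j].
  have := xb 0; rewrite !mxE eqxx addr0 => x0.
  have -> : x 0 0 = f t 0 0 - t / 2 by apply/eqP; rewrite eq_le andbC.
  by rewrite addrAC subrr add0r normrN ger0_norm//; lra.
have := xb j; rewrite !mxE ler_norml; case: ifP => _; lra.
Qed.

(** The volume comparison behind the Hausdorff bound, without a measure: for a
    grid of the box with m ^ d points and step h / m, a ball of radius l holds
    at most (2 l m / h + 1) ^ d points, which is at most (4 l m / h) ^ d once
    the step is at most 2 l. *)
Lemma face_box_ball_cover (R : realType) (d N : nat) (b : 'rV[R]_d.+1) (h : R)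
    (u : 'I_N -> 'rV[R]_d.+1) (l : 'I_N -> R) :
  0 < h -> (forall k, 0 < l k) ->
  face_box b h `<=` \bigcup_k ball (u k) (l k) ->
  h ^+ d <= \sum_(k < N) (4 * l k) ^+ d.
Proof.
move=> h0 l0 cover.
(* Fine enough for the step to be at most twice every radius. *)
pose m := (\max_(k < N) Num.truncn (h / (2 * l k))).+1.
have m0 : 0 < m%:R :> R by rewrite ltr0n.
pose step := h / m%:R.
have step0 : 0 < step by rewrite divr_gt0.
have step_le k : step <= 2 * l k.
  have l2 : 0 < 2 * l k by rewrite mulr_gt0.
  rewrite /step ler_pdivrMr// mulrC -ler_pdivrMr// ltW//.
  by rewrite (lt_le_trans (truncnS_gt _))// ler_nat ltnS leq_bigmax.
pose pt (g : {ffun 'I_d -> 'I_m}) := grid_point (b 0 0) b step g.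
pose q k := (Num.truncn (2 * l k / step)).+1.
pose S k := [set g | `[< ball (u k) (l k) (pt g) >]]%SET.
have card_S k : (#|S k| <= q k ^ d)%N.
  apply: (card_grid_points step0 (a := b 0 0) (b := b)) => // g g'.
  rewrite !finset.in_set => /asboolP[_ gB] /asboolP[_ g'B] i.
  rewrite mulrC -ltr_pdivrMr//; apply: le_lt_trans (truncnS_gt _).
  rewrite ler_pM2r ?invr_gt0//.
  rewrite -[X in X - _](subrK (u k 0 i)) -addrA (le_trans (ler_normD _ _))//.
  rewrite mulr2n mulrDl mul1r lerD// ltW//; last exact: g'B.
  by rewrite distrC; exact: gB.
have pt_cover g : exists k, g \in S k.
  have /cover[k _ kg] : face_box b h (pt g).
    move=> i; case: (unliftP ord0 i) => [j|] ->; last first.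
      by rewrite grid_point0 eqxx addr0 lexx.
    rewrite grid_pointS /= lerDl mulr_ge0 ?(ltW step0)//=.
    rewrite lerD2l /step -mulrA ger_pMr//.
    by rewrite mulrC ler_pdivrMr// mul1r ler_nat ltnW.
  by exists k; rewrite finset.in_set; apply/asboolP.
have count : (m ^ d <= \sum_(k < N) q k ^ d)%N.
  rewrite -[leqLHS](_ : #|[set: {ffun 'I_d -> 'I_m}]%SET| = _); last first.
    by rewrite cardsT card_ffun !card_ord.
  apply: (@leq_trans (\sum_(k < N) #|S k|)); last exact: leq_sum.
  under [leqRHS]eq_bigr do rewrite -sum1_card big_mkcond.
  rewrite exchange_big -sum1_card big_mkcond leq_sum// => g _.
  by have [k kg] := pt_cover g; rewrite (bigD1 k)//= kg; case: ifP.
have -> : h ^+ d = step ^+ d * (m ^ d)%:R.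
  by rewrite natrX -exprMn divfK// gt_eqF.
apply: (@le_trans _ _ (step ^+ d * (\sum_(k < N) q k ^ d)%:R)).
  by rewrite ler_pM2l ?exprn_gt0// ler_nat.
rewrite natr_sum mulr_sumr ler_sum// => k _.
rewrite natrX -exprMn; apply: lerXn2r; rewrite ?nnegrE.
- exact: mulr_ge0 (ltW step0) _.
- exact: mulr_ge0 _ (ltW (l0 k)).
have : step * (Num.truncn (2 * l k / step))%:R <= 2 * l k.
  rewrite mulrC -ler_pdivlMr// truncn_le.
  by apply: divr_ge0; [rewrite mulr_ge0// ltW|exact: ltW].
move=> le_trunc; rewrite /q -[X in step * X]natr1 mulrDr mulr1; have := step_le k; lra.
Qed.

Lemma coord_le_euclidean_dist (R : realType) (n : nat) (x y : 'rV[R]_n)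
    (i : 'I_n) :
  `|x 0 i - y 0 i| <= euclidean_dist x y.
Proof.
rewrite -sqrtr_sqr ler_wsqrtr// (bigD1 i)//= lerDl.
by rewrite sumr_ge0// => j _; rewrite sqr_ge0.
Qed.

Lemma diam_pow_ge0 (R : realType) (n : nat) (s : R) (U : set 'rV[R]_n) :
  (0 <= diam_pow s U)%E.
Proof. by rewrite /diam_pow; case: ifP => // _; exact: poweR_ge0. Qed.

(** The error e makes the radius strictly larger than the diameter, so that the
    ball is open, and positive even if the diameter is 0 or U is empty. For sets
    of diameter at most 1 a larger exponent gives a smaller power, which allows
    the replacement of s by d. *)
Lemma sub_ball_diam_pow (R : realType) (n d : nat) (s e : R)
    (U : set 'rV[R]_n) :
  (0 < d)%N -> s <= d%:R -> 0 < e -> (diam U <= 1%:E)%E ->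
  exists ul : 'rV[R]_n * R, [/\ 0 < ul.2, U `<=` ball ul.1 ul.2 &
    ((ul.2 ^+ d)%:E <= diam_pow s U + e%:E)%E].
Proof.
move=> d0 sd e0 diam1.
have root (z : R) : 0 <= z -> exists2 l, z < l & l ^+ d = z ^+ d + e.
  move=> z0; pose l := (z ^+ d + e) `^ d%:R^-1.
  have l0 : 0 <= l by exact: powR_ge0.
  have ld : l ^+ d = z ^+ d + e.
    rewrite -powR_mulrn// -powRrM mulVf ?pnatr_eq0 -?lt0n//.
    by rewrite powRr1// addr_ge0 ?exprn_ge0// ltW.
  by exists l => //; rewrite -(ltr_pXn2r d0) ?nnegrE// ld ltrDl.
rewrite /diam_pow; case: ifPn => [/eqP ->|/set0P[u Uu]].
  have [l l0 le] := root 0 (lexx _).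
  exists (0, l); split => //=.
  by rewrite le expr0n (gtn_eqF d0) add0r add0e.
have dist_le y : U y -> ((euclidean_dist u y)%:E <= diam U)%E.
  by move=> Uy; apply: ereal_sup_ubound; exists (u, y).
have dist_uu : euclidean_dist u u = 0.
  by rewrite /euclidean_dist big1 ?sqrtr0// => i _; rewrite subrr expr0n.
have diam0 : (0 <= diam U)%E by have := dist_le _ Uu; rewrite dist_uu.
have diam_fin : diam U \is a fin_num.
  by rewrite ge0_fin_numE// (le_lt_trans diam1)// ltry.
have := diam1; have := diam0; rewrite -(fineK diam_fin) !lee_fin.
set z := fine _ => z0 z1; have [l zl ld] := root z z0.
exists (u, l); split => /=; first exact: le_lt_trans zl.
  move=> y Uy; split; first exact: le_lt_trans zl.
  move=> a i; rewrite ord1; apply: le_lt_trans zl.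
  apply: le_trans (coord_le_euclidean_dist _ _ _) _.
  by rewrite -lee_fin fineK// dist_le.
rewrite -EFinD lee_fin ld lerD2r.
case: (eqVneq z 0) => [->|zn0]; first by rewrite expr0n (gtn_eqF d0) powR_ge0.
by rewrite -powR_mulrn// ger_powR// lt_neqAle eq_sym zn0 z0.
Qed.

Lemma hausdorff_measure_face_box_neq0 (R : realType) (d : nat) (s h : R)
    (b : 'rV[R]_d.+1) (F : set 'rV[R]_d.+1) :
  (0 < d)%N -> s <= d%:R -> 0 < h -> face_box b h `<=` F ->
  hausdorff_measure s F != 0.
Proof.
move=> d0 sd h0 QF; apply/negP => /eqP HF.
(* The d-th powers of the radii will sum to at most 2e, and the factor 4 of the
   ball count turns this into half of the volume h ^ d. *)
pose e := h ^+ d / (4 * 4 ^+ d).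
have e0 : 0 < e by rewrite divr_gt0 ?exprn_gt0// mulr_gt0 ?exprn_gt0.
have : (hausdorff_premeasure s 1 F < e%:E)%E.
  apply: (@le_lt_trans _ _ 0%E); last by rewrite lte_fin.
  by rewrite -HF; apply: ereal_sup_ubound; exists 1 => //=.
move=> /ereal_inf_lt[_ [U [FU U1] <-] Ue].
have e2 k : 0 < e / (2 ^ k.+1)%:R by rewrite divr_gt0// ltr0n expn_gt0.
have /choice[ul ulP] k := sub_ball_diam_pow d0 sd (e2 k) (U1 k).
have balls_cover : face_box b h `<=` cover setT (fun k => ball (ul k).1 (ul k).2).
  by move=> x /QF/FU[k _ Ux]; exists k => //; have [_ + _] := ulP k; apply.
have := @face_box_compact R d b h; rewrite compact_cover => /(_ nat setT _ _ balls_cover).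
case=> [k _|D _ D_cover]; first exact: ball_open.
pose N := (\max_(k <- finmap.enum_fset D) k).+1.
have N_cover : face_box b h `<=` \bigcup_(k : 'I_N) ball (ul k).1 (ul k).2.
  move=> x /D_cover[k /= kD xk].
  have kN : (k < N)%N by rewrite ltnS (leq_bigmax_seq k).
  by exists (Ordinal kN).
have := face_box_ball_cover h0 (fun k : 'I_N => let: And3 p _ _ := ulP k in p) N_cover.
under eq_bigr do rewrite exprMn.
rewrite -mulr_sumr; apply/negP; rewrite -ltNge.
have sum_le : \sum_(k < N) (ul k).2 ^+ d <= 2 * e.
  have := @epsilon_trick R (fun k => diam_pow s (U k)) e xpredT
    (fun k => diam_pow_ge0 s (U k)) (ltW e0).
  move=> /le_trans/(_ (leeD2r _ (ltW Ue))); rewrite -EFinD -mulr2n => sum2e.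
  rewrite mulr_natl -lee_fin; apply: le_trans sum2e; rewrite -sumEFin.
  rewrite -(big_mkord xpredT (fun k => ((ul k).2 ^+ d)%:E)).
  apply: le_trans (nneseries_lim_ge N _); last first.
    by move=> k _ _; rewrite adde_ge0 ?diam_pow_ge0 ?lee_fin ?(ltW (e2 k)).
  by apply: lee_sum => k _; have [_ _] := ulP k.
apply: (@le_lt_trans _ _ (4 ^+ d * (2 * e))).
  by rewrite ler_pM2l// exprn_gt0.
have hd : 0 < h ^+ d by rewrite exprn_gt0.
have -> : 4 ^+ d * (2 * e) = h ^+ d / 2 by rewrite /e; field; rewrite expf_neq0.
lra.
Qed.

Lemma hausdorff_dim_ge (R : realType) (d : nat) (f : R -> 'rV[R]_d.+1) :
  (0 < d)%N -> (d%:R%:E <= hausdorff_dim (cube_boundary_union f))%E.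
Proof.
move=> d0; apply: le_ereal_inf_tmp => _ [s [_ Hs] <-]; rewrite lee_fin leNgt.
apply/negP => sd; have half01 : 0 < (2^-1 : R) < 1 by lra.
have half_gt0 : 0 < (2^-1 : R) by lra.
have := hausdorff_measure_face_box_neq0 d0 (ltW sd) half_gt0
  (@face_box_sub R d f _ half01).
by rewrite Hs eqxx.
Qed.

(** * The dimensions of the union *)

Local Open Scope ereal_scope.

Theorem theorem1p3 (R : realType) (n : nat) (hn : (2 <= n)%N)
    (f : R -> 'rV[R]_n) (hf : size_cube_packing f) :
  lower_box_dim (cube_boundary_union f) <= assouad_dim (cube_boundary_union f)
  /\ (n%:R - 2^-1)%:E <= lower_box_dim (cube_boundary_union f)
  /\ (n%:R - 1)%:E <= hausdorff_dim (cube_boundary_union f).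
Proof.
case: n hn f hf => // d d_gt0 f hf.
have dE : (d.+1%:R = d%:R + 1 :> R)%R by rewrite natr1.
have half01 : (0 < (2^-1 : R) < 1)%R by lra.
split; last split.
- pose x := (f 2^-1 - const_mx (2^-1 / 2))%R.
  have Gx : cube_boundary_union f x.
    apply: (face_box_sub half01) => i.
    by rewrite lexx lerDl; case: ifP => // _; lra.
  have radius_gt0 : (0 < 2 * d.+1%:R :> R)%R by rewrite mulr_gt0.
  exact: lower_box_dim_le_assouad radius_gt0 Gx
    (cube_boundary_union_sub_ball hf Gx).
- have -> : (d.+1%:R - 2^-1 = d%:R + 2^-1 :> R)%R by rewrite dE; lra.
  exact: lower_box_dim_ge.
- by rewrite dE addrK; exact: hausdorff_dim_ge.
Qed.
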